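(* Let $k$ be an odd positive integer and let $n$ be a positive integer that is a multiple of $k$. Then $$\left(\frac{n}{k}-1\right)!\;\leq\; M(n,k)\;\leq\; 3^n\,(n/k)!,$$ where $M(n,k)$ is the maximum size of a family of Hamilton paths in the complete graph $K_n$ such that for any two distinct members of the family there is a subpath with $k$ edges (on $k+1$ vertices) of one of the two Hamilton paths that is edge-disjoint from the whole of the other Hamilton path.
   Context: $K_n$ is the complete graph with vertex set $[n]=\{1,\dots,n\}$. Hamilton paths are undirected: a Hamilton path in $K_n$ is a subgraph that is a path visiting all $n$ vertices, identified with its edge set when $n\geq 2$ (so a vertex ordering and its reversal give the same Hamilton path; for $n=1$ there is exactly one, the single-vertex path). A subpath with $k$ edges of a Hamilton path consists of $k$ consecutive edges of it. *)

(* Defs.v *)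
From mathcomp Require Import all_boot.

Set Implicit Arguments.
Unset Strict Implicit.
Unset Printing Implicit Defensive.

(* Edges traversed by a vertex sequence, as unordered pairs; empty for a
   sequence of at most one vertex. *)
Definition edge_set (T : finType) (s : seq T) : {set {set T}} :=
  if s is x :: s' then [set:: pairmap (fun u v => [set u; v]) x s'] else set0.

(* p lists every vertex of K_n exactly once and H is the edge set of the
   corresponding path. The vertex set [n] is represented by 'I_n. *)
Definition ham_ordering (n : nat) (p : n.-tuple 'I_n)
    (H : {set {set 'I_n}}) : bool :=
  uniq p && (H == edge_set p).

(* Hamilton paths are undirected, being identified with their edge sets; for
   n = 1 the only one is set0. *)
Definition ham_path (n : nat) (H : {set {set 'I_n}}) : bool :=
  [exists p : n.-tuple 'I_n, ham_ordering p H].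

(* Subpaths are likewise given by their edge sets; k edges means k.+1
   consecutive vertices. *)
Definition subpath_of (n k : nat) (P H : {set {set 'I_n}}) : bool :=
  [exists p : n.-tuple 'I_n, exists q : k.+1.-tuple 'I_n,
     [&& ham_ordering p H, infix q p & P == edge_set q]].

Definition has_disjoint_subpath (n k : nat) (H H' : {set {set 'I_n}}) : bool :=
  [exists P : {set {set 'I_n}}, subpath_of k P H && [disjoint P & H']].

Definition admissible_family (n k : nat) (F : {set {set {set 'I_n}}}) : bool :=
  [forall H in F, ham_path H] &&
  [forall H in F, forall H' in F, (H != H') ==>
     (has_disjoint_subpath k H H' || has_disjoint_subpath k H' H)].

Definition M (n k : nat) : nat :=
  \max_(F : {set {set {set 'I_n}}} | admissible_family k F) #|F|.

(* Main.v *)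
Require Import Defs.
From mathcomp Require Import all_boot.

Set Implicit Arguments.
Unset Strict Implicit.
Unset Printing Implicit Defensive.

(** Write n = m * k.
    Upper bound: cut an ordering of a Hamilton path H into m blocks of k
    vertices. The m - 1 edges joining consecutive blocks meet every subpath of H
    with k edges, so distinct members of the family have distinct sets of joining
    edges. For k > 1 these sets are matchings, of which there are at most
    3^n (m - 1)!; for k = 1 it is enough that there are at most n! Hamilton paths.
    Lower bound: split the vertices into m classes of size k. For each order of
    the classes with a fixed first one, zigzag between consecutive classes, using
    k edges for each pair (which closes up since k is odd). For two distinct
    orders some pair of classes is consecutive in the first only, and the k
    edges between them in the first path are not used by the second. *)

(** * Edge sets of vertex sequences *)

Lemma mem_edge_set (T : finType) (x0 : T) (s : seq T) (E : {set T}) :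
  reflect (exists2 i, i.+1 < size s & E = [set nth x0 s i; nth x0 s i.+1])
          (E \in edge_set s).
Proof.
case: s => [|x s] /=; first by rewrite inE; constructor; case.
rewrite inE; apply: (iffP (nthP set0)) => -[i]; rewrite size_pairmap => lti.
  by rewrite (nth_pairmap x0) // => <-; exists i.
by move=> ->; exists i; rewrite ?size_pairmap // (nth_pairmap x0).
Qed.

Lemma edge_set_cons2 (T : finType) (x y : T) (s : seq T) :
  edge_set (x :: y :: s) = [set x; y] |: edge_set (y :: s).
Proof. exact: set_cons. Qed.

Lemma edge_set_infix (T : finType) (q p : seq T) :
  infix q p -> edge_set q \subset edge_set p.
Proof.
move=> /infixP[s1 [s2 ->]]; apply/subsetP => E; case: q => [|x q]; first by rewrite inE.
move=> /(mem_edge_set x)[i lti ->]; apply/(mem_edge_set x).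
have nthE j : j < size (x :: q) ->
    nth x (s1 ++ (x :: q) ++ s2) (size s1 + j) = nth x (x :: q) j.
  by move=> ltj; rewrite nth_cat ltnNge leq_addr addKn nth_cat ltj.
exists (size s1 + i); first by rewrite !size_cat -addnS ltn_add2l ltn_addr.
by rewrite -addnS !nthE // ltnW.
Qed.

Lemma edge_set_sorted (T : finType) (R : rel T) (s : seq T) (E : {set T}) :
  sorted R s -> E \in edge_set s -> exists u v, E = [set u; v] /\ R u v.
Proof.
case: s => [|x s]; first by rewrite inE.
move=> /(sortedP x) Rs /(mem_edge_set x)[i lti ->].
by exists (nth x (x :: s) i), (nth x (x :: s) i.+1); split; last exact: Rs.
Qed.

Lemma edge_set_mem (T : finType) (s : seq T) (E : {set T}) (v : T) :
  E \in edge_set s -> v \in E -> v \in s.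
Proof.
case: s => [|x s]; first by rewrite inE.
move=> /(mem_edge_set x)[i lti ->]; rewrite in_set2.
by case/orP=> /eqP->; apply: mem_nth; rewrite // ltnW.
Qed.

Lemma mem_uniq_full (T : finType) (s : seq T) (x : T) :
  uniq s -> size s = #|T| -> x \in s.
Proof.
move=> us szs; have sub : {subset s <= enum T} by move=> y; rewrite mem_enum.
have [|_ ->] := uniq_min_size us sub; first by rewrite -cardE szs.
by rewrite mem_enum.
Qed.

(** * Upper bound: counting matchings and edges joining blocks *)

Lemma card_uniq_edge_sets (n : nat) (F : {set {set {set 'I_n}}}) :
  (forall H, H \in F -> ham_path H) -> #|F| <= n`!.
Proof.
move=> FP; set D := [set t : n.-tuple 'I_n | all predT t & uniq t].
have <-: #|D| = n`! by rewrite /D card_uniq_tuples cardT size_enum_ord ffactnn.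
apply: leq_trans (leq_imset_card (fun t : n.-tuple 'I_n => edge_set t) D).
apply/subset_leq_card/subsetP => H /FP /existsP[p /andP[up /eqP->]].
by apply: imset_f; rewrite inE all_predT.
Qed.

Definition pair_edges (T : finType) (b a : seq T) : {set {set T}} :=
  [set:: [seq [set x.1; x.2] | x <- zip b a]].

(** Carrying each first end to its partner by [g] lets the first ends be listed in the order of
    [enum]. A matching is then given by the set of its first ends and an order of its second
    ends. *)
Lemma pair_edges_sort (T : finType) (b a : seq T) :
  uniq b -> size b = size a ->
  exists2 t, perm_eq t a & pair_edges b a = pair_edges (enum [set:: b]) t.
Proof.
move=> ub sba; case: b ub sba => [|x0 b'] ub sba.
  move/esym/size0nil: sba => ->; exists [::] => //.
  by rewrite /pair_edges; case: (enum _).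
set b := x0 :: b' in ub sba *.
have pb : perm_eq (enum [set:: b]) b.
  by apply: uniq_perm; rewrite ?enum_uniq // => x; rewrite mem_enum inE.
pose g v := nth x0 a (index v b).
have mg : map g b = a.
  apply: (@eq_from_nth _ x0) => [|i]; rewrite size_map // => lti.
  by rewrite (nth_map x0) // /g index_uniq.
exists (map g (enum [set:: b])); first by rewrite -[X in perm_eq _ X]mg perm_map.
have zE (s : seq T) : zip s (map g s) = [seq (v, g v) | v <- s].
  by elim: s => //= v s ->.
rewrite /pair_edges -{1}mg !zE -!map_comp; apply/setP => E; rewrite !in_set.
by apply/esym/perm_mem/perm_map.
Qed.

(* A label in 'I_3 tells the first ends, the second ends and the unmatched
   vertices apart; a permutation of the second ends then gives the pairing. *)
Lemma card_matchings (T : finType) (l : nat) (F : {set {set {set T}}}) :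
  (forall E, E \in F -> exists b a : seq T,
     [/\ size b = l, size a = l, uniq (b ++ a) & E = pair_edges b a]) ->
  #|F| <= 3 ^ #|T| * l`!.
Proof.
move=> FP.
pose lab (c : {ffun T -> 'I_3}) (i : 'I_3) := enum [set v | c v == i].
pose i1 : 'I_3 := inord 1; pose i2 : 'I_3 := inord 2.
(* The labels fix both sets of ends, and only the pairing is left free. The size test bounds every
   [D c] by the factorial of [l]. *)
pose D c := if size (lab c i2) == l then
  [set:: [seq pair_edges (lab c i1) t | t <- permutations (lab c i2)]] else set0.
have cardD c : #|D c| <= l`!.
  rewrite /D; case: eqP => [<-|_]; last by rewrite cards0.
  rewrite -size_permutations ?enum_uniq // cardsE.
  by rewrite -(size_map (pair_edges (lab c i1))) card_size.
have card_bigcup : #|\bigcup_c D c| <= \sum_c #|D c|.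
  elim/big_rec2: _ => [|c N A _ leA]; first by rewrite cards0.
  by rewrite (leq_trans (leq_card_setU _ _)) // leq_add2l.
have FD : F \subset \bigcup_c D c.
  apply/subsetP => E /FP[b [a [sb sa uba ->]]].
  have := uba; rewrite cat_uniq => /and3P[ub /hasPn dba ua].
  pose c := [ffun v => if v \in b then i1 else if v \in a then i2 else ord0].
  have cb : lab c i1 = enum [set:: b].
    apply: eq_enum => v; rewrite !inE ffunE.
    case: (v \in b); first by rewrite eqxx.
    by case: (v \in a); rewrite -val_eqE /= ?inordK.
  have ca : perm_eq a (lab c i2).
    apply: uniq_perm; rewrite ?enum_uniq // => v; rewrite mem_enum inE ffunE.
    have [va|_] := boolP (v \in a); first by rewrite (negPf (dba _ va)) eqxx.
    by case: (v \in b); rewrite -val_eqE /= ?inordK.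
  have [t pt ->] := pair_edges_sort ub (etrans sb (esym sa)).
  apply/bigcupP; exists c => //; rewrite /D -(perm_size ca) sa eqxx inE -cb.
  by apply: map_f; rewrite mem_permutations (perm_trans pt).
apply: leq_trans (subset_leq_card FD) _; apply: leq_trans card_bigcup _.
have -> : 3 ^ #|T| = #|{ffun T -> 'I_3}| by rewrite card_ffun card_ord.
by rewrite -sum_nat_const; apply: leq_sum => c _.
Qed.

(* The positions [j * k - 1, j * k] of the chosen edges cut the path into blocks
   of k vertices, and a path on k.+1 vertices does not fit in one block. *)
Lemma ham_path_transversal (m k : nat) (H : {set {set 'I_(m.+1 * k)}}) :
  1 < k -> ham_path H ->
  exists E : {set {set 'I_(m.+1 * k)}},
  [/\ E \subset H,
      forall P, subpath_of k P H -> ~~ [disjoint P & E]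
    & exists b a : seq 'I_(m.+1 * k),
      [/\ size b = m, size a = m, uniq (b ++ a) & E = pair_edges b a]].
Proof.
move=> k1 /existsP[p /andP[up /eqP HE]].
have k0 : 0 < k by apply: ltnW.
have n0 : 0 < m.+1 * k by rewrite muln_gt0 /=.
pose x0 : 'I_(m.+1 * k) := Ordinal n0.
pose b := [seq nth x0 p (j.+1 * k).-1 | j <- iota 0 m].
pose a := [seq nth x0 p (j.+1 * k) | j <- iota 0 m].
have szp : size p = m.+1 * k by rewrite size_tuple.
have lt_pos j : j < m -> j.+1 * k < m.+1 * k by move=> ltj; rewrite ltn_pmul2r.
have EE e : reflect (exists2 j, j < m &
    e = [set nth x0 p (j.+1 * k).-1; nth x0 p (j.+1 * k)]) (e \in pair_edges b a).
  rewrite inE /b /a zip_map -map_comp; apply: (iffP mapP) => -[j].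
    by rewrite mem_iota => ltj ->; exists j.
  by move=> ltj ->; exists j => //; rewrite mem_iota.
exists (pair_edges b a); split.
- apply/subsetP => e /EE[j ltj ->]; rewrite HE; apply/(mem_edge_set x0).
  by exists (j.+1 * k).-1; rewrite prednK ?muln_gt0 // szp lt_pos.
- move=> P /existsP[p' /existsP[q /and3P[/andP[up' /eqP HE'] qp' /eqP->]]].
  apply/negP => /pred0P dis.
  pose blk v := index v p %/ k.
  have uq : uniq q := infix_uniq qp' up'.
  (* The ordering [p'] that contains [q] need not be [p], but both have edge set [H]. An edge of [q]
     that is not chosen therefore stays in one block of [p]. *)
  have srt : sorted (fun u v => blk u == blk v) q.
    apply/(sortedP x0) => i lti.
    have eq : [set nth x0 q i; nth x0 q i.+1] \in edge_set q.
      by apply/(mem_edge_set x0); exists i.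
    have : [set nth x0 q i; nth x0 q i.+1] \in edge_set p.
      by rewrite -HE HE' (subsetP (edge_set_infix qp')).
    case/(mem_edge_set x0) => j ltj ej.
    have blkj : blk (nth x0 p j) = blk (nth x0 p j.+1).
      rewrite /blk !index_uniq // 1?ltnW // divnS //.
      (* A step of [p] enters a new block only at a multiple of [k], along a chosen edge. *)
      case: (boolP (k %| j.+1)) => // /dvdnP[[|j'] jE]; first by rewrite mul0n in jE.
      have /negP[] := dis [set nth x0 q i; nth x0 q i.+1].
      rewrite /= eq /=; apply/EE; exists j'; last by rewrite -jE.
      by rewrite -ltnS -(ltn_pmul2r k0) -jE -szp.
    have blkE v : v \in [set nth x0 q i; nth x0 q i.+1] -> blk v = blk (nth x0 p j).
      by rewrite ej !inE => /orP[]/eqP->.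
    by apply/eqP; rewrite !blkE // !inE eqxx ?orbT.
  have blk_q : {in tval q &, forall u v, blk u = blk v}.
    case: (tval q) srt => [|x s /= srt]; first by [].
    have tr : transitive (fun u v => blk u == blk v) by move=> ? ? ? /eqP-> /eqP->.
    have sx : {in x :: s, forall u, blk u = blk x}.
      move=> u; rewrite inE => /predU1P[-> //|us].
      exact/esym/eqP/(allP (order_path_min tr srt)).
    by move=> u v us vs; rewrite (sx u) ?(sx v).
  (* Inside one block the position modulo [k] determines the vertex. *)
  have : size q <= size (iota 0 k).
    rewrite -(size_map (fun v => index v p %% k)); apply: uniq_leq_size.
      rewrite map_inj_in_uniq // => u v uq' vq' eqm.
      have mem_p w : w \in p by rewrite mem_uniq_full ?card_ord.
      apply: (index_inj x0 (mem_p u) (mem_p v)).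
      by rewrite (divn_eq (index u p) k) eqm [_ %/ _](blk_q u v) // -divn_eq.
    by move=> _ /mapP[v _ ->]; rewrite mem_iota ltn_mod.
  by rewrite size_tuple size_iota ltnn.
- exists b, a; split => //; rewrite ?size_map ?size_iota //.
  have lt_pred j : j < m -> (j.+1 * k).-1 < m.+1 * k.
    by move=> ltj; apply: leq_ltn_trans (leq_pred _) (lt_pos j ltj).
  have inj_nth : {in gtn (m.+1 * k) &, injective (nth x0 p)}.
    by move=> i j lti ltj /eqP; rewrite nth_uniq ?szp // => /eqP.
  rewrite cat_uniq; apply/and3P; split.
  + rewrite map_inj_in_uniq ?iota_uniq // => i j; rewrite !mem_iota /= => lti ltj.
    move/(inj_nth _ _ (lt_pred _ lti) (lt_pred _ ltj))/(congr1 S).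
    rewrite !prednK ?muln_gt0 // => /eqP.
    by rewrite eqn_pmul2r // => /eqP[].
  (* Second ends stand at positions 0 modulo [k] and first ends at -1; these differ because
     [1 < k]. *)
  + apply/hasPn => v /mapP[j]; rewrite mem_iota => /= ltj ->{v}.
    apply/mapP => -[i]; rewrite mem_iota => /= lti.
    move/(inj_nth _ _ (lt_pos _ ltj) (lt_pred _ lti))/(congr1 (fun x => x.+1 %% k)).
    by rewrite prednK ?muln_gt0 // modnMl -addn1 modnMDl modn_small.
  + rewrite map_inj_in_uniq ?iota_uniq // => i j; rewrite !mem_iota /= => lti ltj.
    move/(inj_nth _ _ (lt_pos _ lti) (lt_pos _ ltj))/eqP.
    by rewrite eqn_pmul2r // => /eqP[].
Qed.

Lemma card_admissible (m k : nat) (F : {set {set {set 'I_(m.+1 * k)}}}) :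
  0 < k -> admissible_family k F -> #|F| <= 3 ^ (m.+1 * k) * m.+1`!.
Proof.
move=> k0 /andP[/forall_inP Fham /forall_inP Fdis].
case: (ltnP 1 k) => [k1|]; last first.
  case: k k0 F Fham {Fdis} => [|[|k]] // _ F Fham _.
  rewrite -[in m.+1`!](muln1 m.+1) (leq_trans (card_uniq_edge_sets Fham)) //.
  by rewrite leq_pmull ?expn_gt0.
(* With the membership in [F] under the quantifier, the choice becomes a function on the whole
   finite type; [set0] is a dummy outside [F]. *)
have exE H : exists E : {set {set 'I_(m.+1 * k)}}, H \in F ->
  [/\ E \subset H, forall P, subpath_of k P H -> ~~ [disjoint P & E]
    & exists b a : seq 'I_(m.+1 * k),
      [/\ size b = m, size a = m, uniq (b ++ a) & E = pair_edges b a]].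
  have [/Fham/(ham_path_transversal k1)[E HE]|_] := boolP (H \in F).
    by exists E.
  by exists set0.
have [f fP] := fin_all_exists exE.
(* Every [k]-edge subpath of [H] meets [f H], which equals [f H'] and so lies in [H']. *)
have disF H H' : H \in F -> H' \in F -> f H = f H' -> ~~ has_disjoint_subpath k H H'.
  move=> HF HF' eqf; apply/existsP => -[P /andP[subP disP]].
  have [_ /(_ P subP) /negP fHP _] := fP _ HF; have [subE _ _] := fP _ HF'.
  by apply: fHP; rewrite eqf (disjointWr subE).
have injf : {in F &, injective f}.
  move=> H H' HF HF' eqf; apply: contraTeq isT => neH.
  have /forall_inP/(_ _ HF')/implyP/(_ neH) := Fdis _ HF.
  by rewrite (negPf (disF _ _ HF HF' eqf)) (negPf (disF _ _ HF' HF (esym eqf))).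
rewrite -(card_in_imset injf).
apply: (@leq_trans (3 ^ (m.+1 * k) * m`!)); last first.
  by rewrite leq_mul // factS leq_pmull.
rewrite -[in 3 ^ _](card_ord (m.+1 * k)); apply: card_matchings.
by move=> _ /imsetP[H HF ->]; have [] := fP _ HF.
Qed.

(** * Lower bound: zigzags through ordered classes *)

Lemma edge_set_self_sorted (T : finType) (s : seq T) :
  sorted (fun u v => [set u; v] \in edge_set s) s.
Proof.
case: s => // x s; apply/(sortedP x) => i lti.
by apply/(mem_edge_set x); exists i.
Qed.

(* At the first place where the two orders differ, the successor in the first
   is neither the predecessor nor the successor in the second. *)
Lemma exists_edge_notin (T : finType) (x : T) (s t : seq T) :
  uniq (x :: s) -> uniq (x :: t) -> size s = size t -> s <> t ->
  exists y z, infix [:: y; z] (x :: s) /\ [set y; z] \notin edge_set (x :: t).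
Proof.
elim: s t x => [|y s IHs] [|z t] x // /andP[xs us] /andP[xt ut] [szst] neq.
have xE (E : {set T}) (u : seq T) : x \in E -> x \notin u -> E \notin edge_set u.
  by move=> xE; apply: contra => /edge_set_mem; apply.
have [eqyz|neyz] := eqVneq y z; last first.
  (* The only edge of [x :: t] at [x] leads to [z]. *)
  exists x, y; split; first by rewrite /= !eqxx prefix0s.
  rewrite edge_set_cons2 in_setU1 negb_or (xE _ (z :: t)) ?in_set2 ?eqxx // andbT.
  apply/eqP => /setP/(_ y); rewrite !in_set2 eqxx orbT (negPf neyz) orbF.
  move=> /esym/eqP yx.
  by rewrite -yx mem_head in xs.
rewrite -{z}eqyz in xt ut neq *.
have [a [b [iab nab]]] : exists a b, infix [:: a; b] (y :: s) /\
    [set a; b] \notin edge_set (y :: t).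
  by apply: IHs => // est; rewrite est in neq.
exists a, b; split; first by rewrite infix_consl iab orbT.
(* The one edge added to those of [y :: t] contains [x], whereas [a] and [b] lie in [y :: s]. *)
rewrite edge_set_cons2 in_setU1 negb_or nab andbT.
apply/eqP => /setP/(_ x); rewrite !in_set2 eqxx => /orP xab.
have abys : {subset [:: a; b] <= y :: s} by apply: mem_infix.
by move/negP: xs; apply; apply: abys; rewrite !inE; apply/orP.
Qed.

Lemma sorted_map_all (T : Type) (R : rel T) (k : nat) (h : nat -> T) (l : seq nat) :
  (forall r r', r < k -> r' < k -> R (h r) (h r')) -> all (gtn k) l ->
  sorted R (map h l).
Proof.
move=> Rh; case: l => //= a l; elim: l a => //= b l IHl a /and3P[lta ltb ltl].
by rewrite Rh //= IHl //= ltb.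
Qed.

(* [f x r] with [r < k] is the r-th vertex of the class x. A class gives its odd
   vertices to the zigzag with the previous class and its even ones to the zigzag
   with the next. A segment has k vertices, so that its last edge leads to the
   first vertex [f y 0] of what follows. *)
Definition segment (T V : Type) (f : T -> nat -> V) (k : nat) (x y : T) : seq V :=
  [seq f (if odd r then y else x) r | r <- iota 0 k].

Fixpoint zigzag (T V : Type) (f : T -> nat -> V) (k : nat) (x : T) (s : seq T) : seq V :=
  if s is y :: s' then segment f k x y ++ zigzag f k y s'
  else [seq f x r | r <- iota 0 k & ~~ odd r].

(** The first class has no predecessor, so its odd vertices open the path; likewise the even
    vertices of the last class close it. *)
Definition zigzag_path (T V : Type) (f : T -> nat -> V) (k : nat) (x : T) (s : seq T) :
  seq V := [seq f x r | r <- iota 0 k & odd r] ++ zigzag f k x s.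

Lemma zigzag_head (T V : Type) (f : T -> nat -> V) (k : nat) (x : T) (s : seq T) :
  0 < k -> exists t, zigzag f k x s = f x 0 :: t.
Proof. by case: k s => [|k] [|y s] //= _; eexists; reflexivity. Qed.

(** The segment from [x] to [y] consists of the even vertices of [x] and the odd ones of [y]. The
    former complete the class [x]; the latter serve as the opening of the path from [y]. *)
Lemma perm_zigzag (T V : eqType) (f : T -> nat -> V) (k : nat) (x : T) (s : seq T) :
  perm_eq (zigzag_path f k x s) [seq f y r | y <- x :: s, r <- iota 0 k].
Proof.
elim: s x => [|y s IHs] x.
  by rewrite /zigzag_path /= cats0 -map_cat perm_map // perm_filterC.
apply: perm_trans (perm_cat (perm_refl _) (IHs y)).
rewrite /zigzag_path catA /= catA perm_cat2r.
set F := fun r => f (if odd r then y else x) r.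
have FE : perm_eq (segment f k x y)
    ([seq f y r | r <- iota 0 k & odd r] ++ [seq f x r | r <- iota 0 k & ~~ odd r]).
  have e1 : [seq f y r | r <- iota 0 k & odd r] =
            [seq F r | r <- iota 0 k & odd r].
    by apply/eq_in_map => r; rewrite mem_filter /F => /andP[->].
  have e2 : [seq f x r | r <- iota 0 k & ~~ odd r] =
            [seq F r | r <- iota 0 k & ~~ odd r].
    by apply/eq_in_map => r; rewrite mem_filter /F => /andP[/negPf->].
  by rewrite e1 e2 -map_cat perm_sym perm_map // perm_filterC.
apply: perm_trans (perm_cat (perm_refl _) FE) _.
rewrite perm_catCA perm_catC perm_cat2r.
by rewrite -map_cat perm_map // perm_filterC.
Qed.

(** Since [k] is odd, the last index [k - 1] is even and its vertex lies in [x], so the closing edge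
    to [f y 0] also crosses between the classes. *)
Lemma segment_sorted (T V : Type) (f : T -> nat -> V) (k : nat) (x y : T) (R : rel V) :
  odd k ->
  (forall r r', r < k -> r' < k -> R (f x r) (f y r') && R (f y r) (f x r')) ->
  sorted R (rcons (segment f k x y) (f y 0)).
Proof.
move=> ok Rxy; have k0 : 0 < k by case: k ok {Rxy}.
apply/(sortedP (f y 0)) => i; rewrite size_rcons size_map size_iota ltnS => lti.
rewrite !nth_rcons !size_map !size_iota lti (nth_map 0) ?size_iota // nth_iota //.
rewrite add0n; move: lti; rewrite leq_eqVlt => /predU1P[ki|lti].
  rewrite ki ltnn eqxx; move: ok; rewrite -ki /= => /negPf->.
  by rewrite -ki in Rxy; have /andP[] := Rxy i 0 (ltnSn i) isT.
rewrite lti (nth_map 0) ?size_iota // nth_iota // add0n /=.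
by have := Rxy i i.+1 (ltnW lti) lti; case: (odd i) => /andP[].
Qed.

(** Edges in the opening and closing runs stay within a class, including the one into [f x 0]; all
    the others come from segments and join consecutive classes. *)
Lemma zigzag_path_sorted (T V : Type) (f : T -> nat -> V) (k : nat) (x : T) (s : seq T)
    (e : rel T) (R : rel V) :
  odd k -> (forall y r r', r < k -> r' < k -> R (f y r) (f y r')) ->
  (forall y z r r', e y z -> r < k -> r' < k -> R (f y r) (f z r') && R (f z r) (f y r')) ->
  path e x s -> sorted R (zigzag_path f k x s).
Proof.
move=> ok Rf Re pxs; have k0 : 0 < k by case: k ok {Rf Re}.
have ltk (p : pred nat) : all (gtn k) [seq r <- iota 0 k | p r].
  by apply/allP => r; rewrite mem_filter mem_iota => /and3P[].
have szz : sorted R (zigzag f k x s).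
  elim: s x pxs => [|y s IHs] x /=; first by move=> _; apply: sorted_map_all (Rf x) (ltk _).
  case/andP=> exy /IHs; have [t ->] := zigzag_head f y s k0.
  move=> syt; rewrite sorted_cat_cons; apply/andP; split => //.
  by apply: segment_sorted => // r r'; apply: Re.
rewrite /zigzag_path; have [t tE] := zigzag_head f x s k0.
rewrite tE in szz *; rewrite sorted_cat_cons; apply/andP; split=> //.
rewrite -map_rcons; apply: sorted_map_all (Rf x) _.
by rewrite all_rcons /= k0 ltk.
Qed.

Lemma segment_infix (T V : eqType) (f : T -> nat -> V) (k : nat) (x y z : T) (s : seq T) :
  0 < k -> infix [:: y; z] (x :: s) ->
  infix (rcons (segment f k y z) (f z 0)) (zigzag_path f k x s).
Proof.
move=> k0 yz; apply: infix_catl.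
elim: s x yz => [|w s IHs] x /=; first by rewrite andbF.
case/orP => [/and3P[/eqP<- /eqP<- _]|/IHs yz]; last exact: infix_catl.
by have [t ->] := zigzag_head f z s k0; rewrite -cat_rcons prefix_infix // prefix_prefix.
Qed.

Lemma zigzag_family (m k : nat) : odd k ->
  exists2 F : {set {set {set 'I_(m.+1 * k)}}}, admissible_family k F & #|F| = m`!.
Proof.
move=> ok; have k0 : 0 < k by case: k ok.
have n0 : 0 < m.+1 * k by rewrite muln_gt0.
(* Classes are intervals of [k] consecutive numbers. The default of [insubd] is never reached for
   [r < k]. *)
pose f (b : 'I_m.+1) r : 'I_(m.+1 * k) := insubd (Ordinal n0) (b * k + r).
pose blk (v : 'I_(m.+1 * k)) : 'I_m.+1 := inord (v %/ k).
have fE b r : r < k -> f b r = b * k + r :> nat.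
  move=> ltr; rewrite val_insubd; case: ifP => // /negP[].
  by apply: (@leq_trans (b.+1 * k)); rewrite ?leq_pmul2r // mulSnr ltn_add2l.
have blkE b r : r < k -> blk (f b r) = b.
  by move=> ltr; rewrite /blk fE // divnMDl // divn_small // addn0 inord_val.
have f_inj b r b' r' : r < k -> r' < k -> f b r = f b' r' -> (b, r) = (b', r').
  move=> ltr ltr' eqf; have eb : b = b' by rewrite -(blkE b r) // eqf blkE.
  by move/(congr1 val): eqf; rewrite /= !fE // eb => /addnI->.
pose s0 := [seq lift (@ord0 m) i | i <- enum 'I_m].
have us0 : uniq (ord0 :: s0) by rewrite -enum_ordSl enum_uniq.
have sz0 : size s0 = m by rewrite size_map size_enum_ord.
pose L s := zigzag_path f k ord0 s.
have Lperm s : perm_eq (L s) [seq f y r | y <- ord0 :: s, r <- iota 0 k].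
  exact: perm_zigzag.
have Lsize s : perm_eq s s0 -> size (L s) == m.+1 * k.
  move=> /perm_size szs.
  by rewrite (perm_size (Lperm s)) size_allpairs size_iota /= szs sz0.
have s_uniq s : perm_eq s s0 -> uniq (ord0 :: s).
  by move=> ss0; rewrite (perm_uniq (_ : perm_eq _ (ord0 :: s0))) ?perm_cons.
have Luniq s : perm_eq s s0 -> uniq (L s).
  move=> ss0; rewrite (perm_uniq (Lperm s)).
  apply: allpairs_uniq; rewrite ?iota_uniq ?s_uniq //.
  move=> u v /allpairsP[[b r] [_ ltr ->]] /allpairsP[[b' r'] [_ ltr' ->]].
  by rewrite !mem_iota in ltr ltr'; apply: f_inj.
have Lham s (ss0 : perm_eq s s0) : ham_ordering (Tuple (Lsize s ss0)) (edge_set (L s)).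
  by rewrite /ham_ordering /= Luniq ?eqxx.
pose R s (u v : 'I_(m.+1 * k)) :=
  (blk u == blk v) || ([set blk u; blk v] \in edge_set (ord0 :: s)).
have Lsorted s : sorted (R s) (L s).
  pose e y z := [set y; z] \in edge_set (ord0 :: s).
  apply: (@zigzag_path_sorted _ _ _ _ _ _ e _ ok).
  - by move=> y r r' ltr ltr'; rewrite /R !blkE // eqxx.
  - rewrite /e /R => y z r r' yz ltr ltr'.
    by rewrite !blkE // [[set z; y]]setUC yz !orbT.
  - exact: (edge_set_self_sorted (ord0 :: s)).
(* That [P] is a nonempty part of the first path serves to show that distinct orders give distinct
   edge sets, hence the exact size of the family. *)
have Ldis s t : perm_eq s s0 -> perm_eq t s0 -> s <> t ->
    exists P, [/\ subpath_of k P (edge_set (L s)), P \subset edge_set (L s),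
                  P != set0 & [disjoint P & edge_set (L t)]].
  move=> ss0 ts0 neq.
  have [|y [z [yz nyz]]] := exists_edge_notin (s_uniq _ ss0) (s_uniq _ ts0) _ neq.
    by rewrite (perm_size ss0) (perm_size ts0).
  have neyz : y != z.
    by have := infix_uniq yz (s_uniq _ ss0); rewrite /= inE andbT.
  pose q := rcons (segment f k y z) (f z 0).
  have szq : size q == k.+1 by rewrite size_rcons size_map size_iota.
  have qL : infix q (L s) := segment_infix f k0 yz.
  exists (edge_set q); split.
  - apply/existsP; exists (Tuple (Lsize s ss0)); apply/existsP; exists (Tuple szq).
    by rewrite Lham qL /=.
  - exact: edge_set_infix.
  - apply/set0Pn; exists [set nth (f z 0) q 0; nth (f z 0) q 1].
    by apply/(mem_edge_set (f z 0)); exists 0; rewrite // (eqP szq) ltnS.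
  (* A common edge would join the classes [y] and [z] by its place in [q]. By its place in [L t] it
     stays in one class or joins neighbours in [t]; neither is possible. *)
  apply/pred0P => E /=; apply/negP => /andP[Eq Et].
  have qsorted : sorted (fun u v => [set blk u; blk v] == [set y; z]) q.
    apply: segment_sorted => // r r' ltr ltr'.
    by rewrite !blkE // eqxx [[set z; y]]setUC eqxx.
  have [u [v [Euv /eqP uvyz]]] := edge_set_sorted qsorted Eq.
  have [u' [v' [Euv' Ruv']]] := edge_set_sorted (Lsorted t) Et.
  have yzE : [set y; z] = [set blk u'; blk v'].
    by rewrite -uvyz -!imset_set1 -!imsetU -Euv Euv'.
  case/orP: Ruv' => [/eqP eqb|]; last by rewrite -yzE (negPf nyz).
  have: #|[set y; z]| = #|[set blk u'; blk v']| by rewrite yzE.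
  by rewrite !cards2 neyz eqb eqxx.
pose Fs := [seq edge_set (L s) | s <- permutations s0].
have FsP H : H \in Fs -> exists2 s, perm_eq s s0 & H = edge_set (L s).
  by case/mapP=> s; rewrite mem_permutations => ss0 ->; exists s.
exists [set:: Fs].
  apply/andP; split.
    apply/forall_inP => H; rewrite inE => /FsP[s ss0 ->].
    by apply/existsP; exists (Tuple (Lsize s ss0)).
  apply/forall_inP => H; rewrite inE => /FsP[s ss0 ->].
  apply/forall_inP => H'; rewrite inE => /FsP[t ts0 ->].
  apply/implyP => neH; apply/orP; left.
  have [|P [sP _ _ dP]] := Ldis s t ss0 ts0; first by move=> st; rewrite st eqxx in neH.
  by apply/existsP; exists P; rewrite sP.
rewrite cardsE (card_uniqP _) ?size_map ?size_permutations ?sz0 //.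
  by move: us0 => /andP[].
rewrite map_inj_in_uniq ?permutations_uniq // => s t.
rewrite !mem_permutations => ss0 ts0 eqH; apply/eqP/negPn/negP => /eqP neq.
have [P [_ subP neP]] := Ldis s t ss0 ts0 neq.
by rewrite -eqH => /disjoint_setI0; rewrite (setIidPl subP) => P0; rewrite P0 eqxx in neP.
Qed.

Theorem theorem3 (n k : nat) (hk0 : 0 < k) (hk : odd k) (hn : 0 < n)
    (hkn : k %| n) :
  (n %/ k - 1)`! <= M n k /\ M n k <= 3 ^ n * (n %/ k)`!.
Proof.
case/dvdnP: hkn hn => -[|m] -> // _; rewrite mulnK // subn1; split.
  by have [F admF <-] := zigzag_family m hk; apply: leq_bigmax_cond.
by apply/bigmax_leqP => F; apply: card_admissible.
Qed.
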